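(* Let $1\le p\le n-1$. Then $$\operatorname{rank} RQ_p(n)=\begin{cases}\displaystyle\sum_{r=p}^{n}\binom{n}{r}\binom{r-1}{p-1}, & \text{if } p=1 \text{ or } \lceil n/2\rceil+1\le p\le n-1,\\[2mm] \displaystyle (n-2p+2)+\sum_{r=p}^{n}\binom{n}{r}\binom{r-1}{p-1}, & \text{if } 2\le p\le \lceil n/2\rceil.\end{cases}$$
   Context: Let $[n]=\{1,\dots,n\}$ with its usual order. A partial transformation of $[n]$ is a function $\rho$ whose domain $\mathrm{Dom}\,\rho$ and image $\mathrm{Im}\,\rho$ are subsets of $[n]$ (the empty map is allowed). Maps are written on the right and composed left to right: $x(\rho\sigma)=(x\rho)\sigma$. $\rho$ is isotone if $x\le y$ implies $x\rho\le y\rho$ for all $x,y\in\mathrm{Dom}\,\rho$; antitone if $x\le y$ implies $x\rho\ge y\rho$; monotone if isotone or antitone; decreasing if $x\rho\le x$ for all $x\in\mathrm{Dom}\,\rho$. $\mathcal{DORP}_n$ is the monoid, under composition, of all monotone and decreasing partial transformations of $[n]$. The height of $\rho$ is $|\mathrm{Im}\,\rho|$. For $0\le p\le n-1$, $I(n,p)=\{\rho\in\mathcal{DORP}_n:|\mathrm{Im}\,\rho|\le p\}$, a two-sided ideal. For $p\ge1$, $RQ_p(n)=I(n,p)/I(n,p-1)$ is the Rees quotient: its nonzero elements are the elements of $\mathcal{DORP}_n$ of height exactly $p$, and a product of two of them is their composite if that has height $p$ and is the zero $\mathbf{0}$ otherwise. The rank of a finitely generated semigroup $S$ is $\min\{|T|:T\subseteq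 S,\ \langle T\rangle=S\}$, where $\langle T\rangle$ is the subsemigroup generated by $T$. *)

(* Defs.v *)
From HB Require Import structures.
From mathcomp Require Import all_boot.

Set Implicit Arguments.
Unset Strict Implicit.
Unset Printing Implicit Defensive.

#[short(type="finSemigroupType")]
HB.structure Definition FinSemigroup := {S of Semigroup S & Finite S}.

Section Rank.

Variable S : finSemigroupType.
Implicit Types T A : {set S}.

Definition mul_closed A := [forall x in A, forall y in A, (x * y)%g \in A].

(* As the smallest closed superset of T; it is empty when T is. *)
Definition subsemigroup_gen T : {set S} :=
  \bigcap_(A : {set S} | (T \subset A) && mul_closed A) A.

Definition generates T := subsemigroup_gen T == [set: S].

Definition rank : nat := #|[arg min_(T < [set: S] | generates T) #|T|]|.

Lemma generates_setT : generates [set: S].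
Proof.
rewrite /generates -subTset; apply/bigcapsP => A /andP[].
by rewrite subTset => /eqP->.
Qed.

Lemma rankP :
  (exists2 T, generates T & #|T| = rank) /\
  (forall T, generates T -> rank <= #|T|).
Proof.
rewrite /rank; case: arg_minnP => [|T genT minT]; first exact: generates_setT.
by split; first exists T.
Qed.

End Rank.

Arguments rank S : clear implicits.

(* The chain {1, ..., n} is encoded by 'I_n, that is {0, ..., n-1}, to which it
   is order-isomorphic; rho x = None means that x is outside the domain. *)
Definition ptrans n := {ffun 'I_n -> option 'I_n}.

Section PartialTransformations.

Variable n : nat.
Implicit Types rho sigma : ptrans n.

Definition im rho : {set 'I_n} := [set y | [exists x, rho x == Some y]].

Definition isotone rho :=
  [forall x, forall y, forall x', forall y',
     [&& rho x == Some x', rho y == Some y' & x <= y] ==> (x' <= y')].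

Definition antitone rho :=
  [forall x, forall y, forall x', forall y',
     [&& rho x == Some x', rho y == Some y' & x <= y] ==> (y' <= x')].

Definition monotone rho := isotone rho || antitone rho.

Definition decreasing rho :=
  [forall x, forall x', (rho x == Some x') ==> (x' <= x)].

(* Maps act on the right: pcomp rho sigma is rho followed by sigma. *)
Definition pcomp rho sigma : ptrans n := [ffun x => obind sigma (rho x)].

Definition pid : ptrans n := [ffun x => Some x].

Lemma isotoneP rho :
  reflect (forall x y x' y', rho x = Some x' -> rho y = Some y' ->
             x <= y -> x' <= y')
          (isotone rho).
Proof.
apply: (iffP forallP) => [H x y x' y' hx hy hxy|H x].
  move/forallP: (H x) => /(_ y) /forallP /(_ x') /forallP /(_ y').
  by rewrite hx hy hxy !eqxx.
apply/forallP => y; apply/forallP => x'; apply/forallP => y'.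
by apply/implyP => /and3P[/eqP hx /eqP hy]; apply: H hx hy.
Qed.

Lemma antitoneP rho :
  reflect (forall x y x' y', rho x = Some x' -> rho y = Some y' ->
             x <= y -> y' <= x')
          (antitone rho).
Proof.
apply: (iffP forallP) => [H x y x' y' hx hy hxy|H x].
  move/forallP: (H x) => /(_ y) /forallP /(_ x') /forallP /(_ y').
  by rewrite hx hy hxy !eqxx.
apply/forallP => y; apply/forallP => x'; apply/forallP => y'.
by apply/implyP => /and3P[/eqP hx /eqP hy]; apply: H hx hy.
Qed.

Lemma decreasingP rho :
  reflect (forall x x', rho x = Some x' -> x' <= x) (decreasing rho).
Proof.
apply: (iffP forallP) => [H x x' hx|H x].
  by move/forallP: (H x) => /(_ x'); rewrite hx eqxx.
by apply/forallP => x'; apply/implyP => /eqP; apply: H.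
Qed.

Lemma imP rho y : reflect (exists x, rho x = Some y) (y \in im rho).
Proof.
rewrite inE; apply: (iffP existsP) => -[x hx]; exists x; exact/eqP.
Qed.

Lemma pcomp_Some rho sigma x z :
  pcomp rho sigma x = Some z -> exists2 y, rho x = Some y & sigma y = Some z.
Proof. by rewrite ffunE; case: (rho x) => //= y; exists y. Qed.

Lemma pcompA : associative pcomp.
Proof.
move=> f g h; apply/ffunP => x; rewrite !ffunE.
by case: (f x) => //= y; rewrite ffunE.
Qed.

Lemma pcomp1p : left_id pid pcomp.
Proof. by move=> f; apply/ffunP => x; rewrite !ffunE. Qed.

Lemma pcompp1 : right_id pid pcomp.
Proof.
move=> f; apply/ffunP => x; rewrite !ffunE.
by case: (f x) => //= y; rewrite ffunE.
Qed.

Lemma monotone_pcomp rho sigma :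
  monotone rho -> monotone sigma -> monotone (pcomp rho sigma).
Proof.
move=> /orP[/isotoneP|/antitoneP] hr /orP[/isotoneP|/antitoneP] hs;
  apply/orP; [left; apply/isotoneP|right; apply/antitoneP
             |right; apply/antitoneP|left; apply/isotoneP];
  move=> x y x' y' /pcomp_Some[u xu ux'] /pcomp_Some[v yv vy'] le_xy;
  by have le_uv := hr _ _ _ _ xu yv le_xy;
     [apply: hs ux' vy' le_uv || apply: hs vy' ux' le_uv].
Qed.

Lemma decreasing_pcomp rho sigma :
  decreasing rho -> decreasing sigma -> decreasing (pcomp rho sigma).
Proof.
move=> /decreasingP hr /decreasingP hs; apply/decreasingP => x z.
by case/pcomp_Some => y /hr le_yx /hs le_zy; apply: leq_trans le_zy le_yx.
Qed.

Lemma monotone_pid : monotone pid.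
Proof.
by apply/orP; left; apply/isotoneP => x y x' y'; rewrite !ffunE => -[<-] [<-].
Qed.

Lemma decreasing_pid : decreasing pid.
Proof. by apply/decreasingP => x x'; rewrite ffunE => -[<-]. Qed.

Lemma card_im_pcompr rho sigma : #|im (pcomp rho sigma)| <= #|im sigma|.
Proof.
apply/subset_leq_card/subsetP => z /imP[x /pcomp_Some[y _ yz]].
by apply/imP; exists y.
Qed.

Lemma card_im_pcompl rho sigma : #|im (pcomp rho sigma)| <= #|im rho|.
Proof.
rewrite -(card_imset (mem (im (pcomp rho sigma))) (@Some_inj _)).
apply: leq_trans (leq_imset_card sigma (mem (im rho))).
apply/subset_leq_card/subsetP => _ /imsetP[z /imP[x /pcomp_Some[y xy yz]] ->].
by rewrite -yz; apply: imset_f; apply/imP; exists x.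
Qed.

End PartialTransformations.

Record DORP n := MkDORP {
  dorp_val :> ptrans n;
  dorp_prop : monotone dorp_val && decreasing dorp_val
}.

HB.instance Definition _ n := [isSub for @dorp_val n].
HB.instance Definition _ n := [Finite of DORP n by <:].

Section DORPMonoid.

Variable n : nat.
Implicit Types rho sigma : DORP n.

Fact dorp_mul_subproof rho sigma :
  monotone (pcomp rho sigma) && decreasing (pcomp rho sigma).
Proof.
have /andP[rm rd] := dorp_prop rho; have /andP[sm sd] := dorp_prop sigma.
by rewrite monotone_pcomp // decreasing_pcomp.
Qed.

Fact dorp_one_subproof : monotone (pid n) && decreasing (pid n).
Proof. by rewrite monotone_pid decreasing_pid. Qed.

Definition dorp_mul rho sigma := MkDORP (dorp_mul_subproof rho sigma).
Definition dorp_one := MkDORP dorp_one_subproof.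

Fact dorp_mulA : associative dorp_mul.
Proof. by move=> f g h; apply: val_inj; apply: pcompA. Qed.

Fact dorp_1mul : left_id dorp_one dorp_mul.
Proof. by move=> f; apply: val_inj; apply: pcomp1p. Qed.

Fact dorp_mul1 : right_id dorp_one dorp_mul.
Proof. by move=> f; apply: val_inj; apply: pcompp1. Qed.

HB.instance Definition _ :=
  isMonoid.Build (DORP n) dorp_mulA dorp_1mul dorp_mul1.

Definition height rho : nat := #|im rho|.

Definition I_ (p : nat) : {set DORP n} := [set rho | height rho <= p].

Lemma I_mull p rho sigma : sigma \in I_ p -> (rho * sigma)%g \in I_ p.
Proof. by rewrite !inE; apply: leq_trans; apply: card_im_pcompr. Qed.

Lemma I_mulr p rho sigma : rho \in I_ p -> (rho * sigma)%g \in I_ p.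
Proof. by rewrite !inE; apply: leq_trans; apply: card_im_pcompl. Qed.

End DORPMonoid.

(* The Rees quotient I(n,p) / I(n,p-1), for p >= 1, with None as the zero. *)
Definition RQ (p n : nat) :=
  option {rho : DORP n | rho \in I_ n p :\: I_ n p.-1}.

HB.instance Definition _ p n := Finite.on (RQ p n).

Section ReesQuotient.

Variables p n : nat.

(* On I(n,p) this is the quotient map: it is None exactly on I(n,p-1). *)
Definition rees_proj (rho : DORP n) : RQ p n := insub rho.

Definition RQ_mul (a b : RQ p n) : RQ p n :=
  if (a, b) is (Some rho, Some sigma) then rees_proj (val rho * val sigma)%g
  else None.

Lemma in_layer (rho : DORP n) :
  0 < p -> (rho \in I_ n p :\: I_ n p.-1) = (height rho == p).
Proof. by case: p => // q _; rewrite !inE -ltnNge eqn_leq andbC. Qed.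

Variant rees_proj_spec rho : RQ p n -> Prop :=
  | ReesProjSome u of val u = rho : rees_proj_spec rho (Some u)
  | ReesProjNone of rho \in I_ n p.-1 : rees_proj_spec rho None.

Lemma rees_projP rho : rho \in I_ n p -> rees_proj_spec rho (rees_proj rho).
Proof.
move=> rI; rewrite /rees_proj; case: insubP => [u _ vu|]; first by left.
by rewrite in_setD rI andbT negbK; right.
Qed.

Lemma rees_proj0 rho : rho \in I_ n p.-1 -> rees_proj rho = None.
Proof. by move=> rI; rewrite /rees_proj insubN // in_setD rI. Qed.

Fact RQ_mulA : associative RQ_mul.
Proof.
case=> [r|] [s|] [t|] //; last by rewrite /RQ_mul; case: (rees_proj _).
have /setDP[rI _] := valP r; have /setDP[sI _] := valP s.
transitivity (rees_proj (val r * val s * val t)%g); rewrite /RQ_mul.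
  case: (rees_projP (I_mulr (val t) sI)) => [u ->|stI]; first by rewrite mulgA.
  by rewrite -mulgA rees_proj0 // I_mull.
case: (rees_projP (I_mulr (val s) rI)) => [u ->|rsI] //.
by rewrite rees_proj0 // I_mulr.
Qed.

HB.instance Definition _ := isSemigroup.Build (RQ p n) RQ_mulA.

End ReesQuotient.

(* Main.v *)
Require Import Defs.
From mathcomp Require Import all_boot.
From mathcomp Require Import zify.

(* Two families of subsets of the Rees quotient are prime, i.e. have a
   complement that is a subsemigroup, so that every generating set meets each of
   their members: the singletons of nonzero isotone idempotents, of which there
   is one for every domain and every choice of block minima in it, and, for
   [p >= 2], the sets of maps [f] with [f (q + i) = q - i] for all [i < p], where
   [p - 1 <= q <= n - p].  These sets are pairwise disjoint, which bounds the
   rank from below.  Conversely, an isotone map is a product of idempotents that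
   move one image point at a time, and an antitone map with largest image point
   [q] is an isotone map, followed by the reflection [q + i |-> q - i], followed
   by an isotone map. *)

Set Implicit Arguments.
Unset Strict Implicit.
Unset Printing Implicit Defensive.

(* [ssrfun.pcomp] would otherwise be meant. *)
Local Notation pcomp := Defs.pcomp.

(** * Generating sets and prime sets *)

Lemma generatesP (S : finSemigroupType) (T : {set S}) :
  reflect (forall A : {set S}, T \subset A -> mul_closed A -> A = [set: S])
          (generates T).
Proof.
apply: (iffP eqP) => [genT A TA clA|H].
  apply/eqP; rewrite -subTset -genT.
  by apply: (bigcap_inf A); rewrite TA clA.
apply/eqP; rewrite -subTset; apply/bigcapsP => A /andP[TA clA].
by rewrite (H A TA clA).
Qed.

Lemma mul_closedP (S : finSemigroupType) (A : {set S}) :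
  reflect {in A &, forall x y, (x * y)%g \in A} (mul_closed A).
Proof.
apply: (iffP forall_inP) => [H x y Ax Ay|H x Ax].
  exact: (forall_inP (H x Ax)).
by apply/forall_inP => y; apply: H.
Qed.

Definition prime_set (S : finSemigroupType) (A : {set S}) :=
  forall x y : S, (x * y)%g \in A -> x \in A \/ y \in A.

(** Primality makes the complement of [A] closed under products. If [T] missed [A], this complement
    would contain [T] and hence be everything, leaving [A] empty. *)
Lemma generates_prime_set (S : finSemigroupType) (T A : {set S}) :
  generates T -> prime_set A -> A != set0 -> exists2 x, x \in A & x \in T.
Proof.
move=> /generatesP genT prA A0.
have [/exists_inP[x xA xT]|nAT] := boolP [exists x in A, x \in T].
  by exists x.
case/negP: A0; rewrite -setCT -(genT (~: A)) ?setCK //.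
  apply/subsetP => x xT; rewrite in_setC; apply: contra nAT => xA.
  by apply/exists_inP; exists x.
apply/mul_closedP => x y; rewrite !in_setC => xA yA.
by apply/negP => /prA[]; apply/negP.
Qed.

(** Choosing a point of [T] in each [A i] gives an injection of [I] into [T], because the sets are
    pairwise disjoint. *)
Lemma leq_card_generates (S : finSemigroupType) (I : finType)
    (A : I -> {set S}) (T : {set S}) :
    generates T -> (forall i, prime_set (A i)) -> (forall i, A i != set0) ->
    (forall i j x, x \in A i -> x \in A j -> i = j) ->
  #|I| <= #|T|.
Proof.
move=> genT prA A0 disA.
have ex i : exists x, (x \in A i) && (x \in T).
  by have [x xA xT] := generates_prime_set genT (prA i) (A0 i); exists x; apply/andP.
pose f i := xchoose (ex i).
have fP i : (f i \in A i) && (f i \in T) := xchooseP (ex i).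
rewrite -(card_codom (f := f)); last first.
  move=> i j eqf; have /andP[fi _] := fP i; have /andP[fj _] := fP j.
  by apply: disA fi _; rewrite eqf.
apply/subset_leq_card/subsetP => _ /codomP[i ->].
by case/andP: (fP i).
Qed.

(** * Idempotents: rigidity under factorization, and their count *)

Section PartialMaps.

Variable n : nat.
Implicit Types (a b e f g h : ptrans n) (D M : {set 'I_n}).

(** The set [b @: im a] has at most [#|im a|] elements and contains a copy of [im (pcomp a b)]. When
    no height is lost the two coincide, so [b] identifies no points of [im a] and never takes the
    value [None] there. *)
Lemma card_im_pcomp_inj a b : #|im a| <= #|im (pcomp a b)| ->
  {in im a &, injective b} /\ {in im a, forall y, b y}.
Proof.
move=> le_im.
pose A : {set 'I_n} := im a; pose B : {set 'I_n} := im (pcomp a b).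
have sub : Some @: B \subset b @: A.
  apply/subsetP => _ /imsetP[z /imP[x /pcomp_Some[y xy yz]] ->].
  by rewrite -yz; apply: imset_f; apply/imP; exists x.
have cardS : #|Some @: B| = #|B| by apply: card_imset; apply: Some_inj.
have eqS : Some @: B = b @: A.
  apply/eqP; rewrite eqEcard sub cardS.
  exact: leq_trans (leq_imset_card _ _) le_im.
split=> [|y ya].
  by apply/imset_injP; rewrite eqn_leq leq_imset_card -eqS cardS.
by have : b y \in b @: A by [exact: imset_f]; rewrite -eqS => /imsetP[z _ ->].
Qed.

(** A fixed point [y] of [e] satisfies [y = b (a y) <= a y <= y], so [a] fixes it too. If [e x = y],
    then [b] sends both [a x] and [y] to [y], and injectivity of [b] on [im a] gives [a x = y].
    Totality of [b] on [im a] keeps [a] undefined outside the domain of [e]. *)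
Lemma idempotent_left_factor a b e :
    decreasing a -> decreasing b -> #|im a| = #|im e| ->
    pcomp a b = e -> pcomp e e = e ->
  a = e.
Proof.
move=> /decreasingP da /decreasingP db im_ae abe ee.
have [|inj_b tot_b] := @card_im_pcomp_inj a b; first by rewrite abe im_ae.
have im_a x y : a x = Some y -> y \in im a by move=> axy; apply/imP; exists x.
have fix_e x y : e x = Some y -> e y = Some y.
  move=> exy; have := exy; rewrite -{1}ee => /pcomp_Some[z].
  by rewrite exy => -[<-].
have fix_a y : e y = Some y -> a y = Some y.
  rewrite -{1}abe => /pcomp_Some[z ayz bzy].
  have := da _ _ ayz; have := db _ _ bzy => yz zy.
  by rewrite ayz; congr Some; apply/val_inj/eqP; rewrite eqn_leq yz zy.
apply/ffunP => x; case exy: (e x) => [y|].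
  have eyy := fix_e _ _ exy; have ayy := fix_a _ eyy.
  move: exy eyy; rewrite -{1 2}abe => /pcomp_Some[z axz bzy].
  case/pcomp_Some => y'; rewrite ayy => -[<-] byy.
  rewrite axz; congr Some.
  by apply: inj_b; rewrite ?bzy ?byy //; apply: im_a; eassumption.
case axz: (a x) => [z|] //.
have := tot_b _ (im_a _ _ axz); case bz: (b z) => [y|] // _.
by move: exy; rewrite -abe ffunE axz /= bz.
Qed.

(** A pair encodes a division of the chain [z.1] into [p] consecutive blocks with minima [z.2]. The
    last condition amounts to the least point of a nonempty [z.1] being in [z.2]. *)
Definition partition_pairs p : {set {set 'I_n} * {set 'I_n}} :=
  [set z : {set 'I_n} * {set 'I_n} | [&& z.2 \subset z.1, #|z.2| == p &
     [forall d in z.1, exists m in z.2, m <= d]]].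

Lemma partition_pairsP p D M :
  reflect [/\ M \subset D, #|M| = p &
             forall d, d \in D -> exists2 m, m \in M & m <= d]
          ((D, M) \in partition_pairs p).
Proof.
rewrite inE /=; apply: (iffP and3P) => -[MD cM H]; split=> //.
- exact/eqP.
- by move=> d dD; apply/exists_inP; apply: (forall_inP H).
- exact/eqP.
by apply/forall_inP => d dD; apply/exists_inP; apply: H.
Qed.

(* The idempotent with domain [D] and image [M]; [M] is the set of minima of
   its kernel classes. *)
Definition retraction D M : ptrans n :=
  [ffun x => if x \in D then
     [pick m in M | (m <= x) && [forall m' in M, (m' <= x) ==> (m' <= m)]]
   else None].

Lemma retractionP D M x m :
  retraction D M x = Some m <->
  [/\ x \in D, m \in M, m <= x & forall m', m' \in M -> m' <= x -> m' <= m].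
Proof.
rewrite ffunE; split=> [|[-> mM mx maxm]].
  case: ifP => // xD; case: pickP => // m0 /and3P[mM mx /forall_inP maxm] [<-].
  by split=> // m' m'M; apply/implyP; apply: maxm.
case: pickP => [m0 /and3P[m0M m0x /forall_inP maxm0]|/(_ m)/negP[]].
  congr Some; apply/val_inj/eqP; rewrite eqn_leq maxm //.
  exact: (implyP (maxm0 _ mM)).
by rewrite mM mx; apply/forall_inP => m' m'M; apply/implyP; apply: maxm.
Qed.

Lemma retraction_fix D M m : m \in D -> m \in M -> retraction D M m = Some m.
Proof. by move=> mD mM; apply/retractionP. Qed.

Lemma isotone_retraction D M : isotone (retraction D M).
Proof.
apply/isotoneP => x y x' y' /retractionP[_ x'M x'x _] /retractionP[_ _ _ maxy] xy.
exact: maxy (leq_trans x'x xy).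
Qed.

Lemma decreasing_retraction D M : decreasing (retraction D M).
Proof. by apply/decreasingP => x x' /retractionP[]. Qed.

Section Retraction.

Variables (p : nat) (D M : {set 'I_n}).
Hypothesis DM : (D, M) \in partition_pairs p.

Lemma im_retraction : im (retraction D M) = M.
Proof.
have [/subsetP MD _ _] := partition_pairsP _ _ _ DM.
apply/setP => m; apply/imP/idP => [[x /retractionP[]] //|mM].
by exists m; apply: retraction_fix => //; apply: MD.
Qed.

Lemma retraction_dom x : retraction D M x = (x \in D) :> bool.
Proof.
have [_ _ ex] := partition_pairsP _ _ _ DM.
apply/idP/idP => [|xD]; first by rewrite ffunE; case: ifP.
have [m0 m0M m0x] := ex _ xD.
have P0 : (m0 \in M) && (m0 <= x) by rewrite m0M.
case: (arg_maxnP (P := fun m => (m \in M) && (m <= x)) val P0) => m /andP[mM mx] maxm.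
suff -> : retraction D M x = Some m by [].
by apply/retractionP; split=> // m' m'M m'x; apply: maxm; rewrite m'M.
Qed.

Lemma retraction_idem : pcomp (retraction D M) (retraction D M) = retraction D M.
Proof.
have [/subsetP MD _ _] := partition_pairsP _ _ _ DM.
apply/ffunP => x; rewrite [LHS]ffunE; case E: (retraction D M x) => [m|] //=.
by case/retractionP: E => _ mM _ _; apply: retraction_fix => //; apply: MD.
Qed.

End Retraction.

Lemma retraction_inj p :
  {in partition_pairs p &, injective (fun z => retraction z.1 z.2)}.
Proof.
move=> [D M] [D' M'] /= DM DM' eqR; congr pair; last first.
  by rewrite -(im_retraction DM) eqR (im_retraction DM').
by apply/setP => x; rewrite -(retraction_dom DM) eqR (retraction_dom DM').
Qed.

(** Once a nonempty domain of size [r] is chosen, its least point is forced into the set of minima,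
    and the other [p - 1] minima are free among the remaining [r - 1] points. *)
Lemma card_partition_pairs p : 0 < p ->
  #|partition_pairs p| = \sum_(p <= r < n.+1) 'C(n, r) * 'C(r - 1, p - 1).
Proof.
move=> p_gt0.
(* The empty domain is treated apart: by truncated subtraction the binomial formula would give 1 at
   [r = 0] when [p = 1]. *)
pose F r := if r is 0 then 0 else 'C(r - 1, p - 1).
have cardM D : #|[set M | (D, M) \in partition_pairs p]| = F #|D|.
  have [->|[d0 d0D]] := set_0Vmem D.
    rewrite cards0 /=; apply: eq_card0 => M; rewrite inE.
    apply/negP => /partition_pairsP[]; rewrite subset0 => /eqP-> .
    by rewrite cards0 => p0; rewrite -p0 in p_gt0.
  case: (arg_minnP (P := fun d => d \in D) val d0D) => d dD mind.
  rewrite (cardsD1 d) dD add1n /= subn1 /=.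
  rewrite -(cards_draws (D :\ d) (p - 1)).
  rewrite -(card_in_imset (f := fun B : {set 'I_n} => d |: B)); last first.
    move=> B1 B2; rewrite !inE => /andP[/subsetP s1 _] /andP[/subsetP s2 _] eqU.
    have dB (B : {set 'I_n}) : {subset B <= D :\ d} -> (d |: B) :\ d = B.
      by move=> sB; rewrite setU1K //; apply/negP => /sB; rewrite !inE eqxx.
    by rewrite -(dB _ s1) eqU dB.
  apply: eq_card => M; rewrite inE; apply/partition_pairsP/imsetP.
    move=> [/subsetP MD cM /(_ d dD)[m mM md]].
    have dM : d \in M.
      suff <- : m = d by [].
      by apply/val_inj/eqP; rewrite eqn_leq md mind ?MD.
    exists (M :\ d); last by rewrite setD1K.
    rewrite inE setSD; last exact/subsetP.
    by move: cM; rewrite (cardsD1 d) dM => <-; rewrite add1n subn1 /=.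
  move=> [B]; rewrite inE => /andP[BD /eqP cB] ->.
  have dB : d \notin B by apply/negP => /(subsetP BD); rewrite !inE eqxx.
  split.
  - by rewrite subUset sub1set dD; apply: subset_trans BD (subD1set _ _).
  - by rewrite cardsU1 dB cB add1n subn1 prednK.
  by move=> x xD; exists d; [rewrite !inE eqxx|apply: mind].
have -> : #|partition_pairs p| = \sum_(D : {set 'I_n}) F #|D|.
  pose Q D M := (D, M) \in partition_pairs p.
  rewrite -sum1_card (eq_bigl (fun z : _ * _ => true && Q z.1 z.2)); last by case.
  rewrite -(pair_big_dep xpredT Q (fun _ _ => 1)) /=.
  apply: eq_bigr => D _; rewrite sum1_card -cardM.
  by apply: eq_card => M; rewrite [RHS]inE.
have cardD D : #|D| < n.+1 by have := max_card (mem D); rewrite card_ord.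
rewrite (partition_big (fun D => Ordinal (cardD D)) xpredT) //=.
rewrite (eq_bigr (fun r : 'I_n.+1 => 'C(n, r) * F r)); last first.
  move=> r _; rewrite (eq_bigr (fun _ => F r)); last by move=> D /eqP <-.
  rewrite sum_nat_const; congr (_ * _).
  rewrite -[X in 'C(X, r)](card_ord n) -card_draws.
  by apply: eq_card => D; rewrite [RHS]inE.
rewrite -(big_mkord xpredT (fun r => 'C(n, r) * F r)).
have [pn|np] := leqP p n.+1.
  rewrite (big_cat_nat (n:=p)) //= big_nat big1 ?add0n; last first.
    case=> [|r] /andP[_ rp] /=; rewrite ?muln0 //.
    by rewrite (bin_small (n := r.+1 - 1)) ?muln0 //; lia.
  apply: eq_big_nat => -[|r] /andP[pr _]; last by [].
  by move: pr; rewrite leqNgt p_gt0.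
rewrite [RHS]big_geq; last exact: ltnW.
rewrite big_nat big1 // => -[|r] /andP[_ rp] /=; rewrite ?muln0 //.
by rewrite (bin_small (n := r.+1 - 1)) ?muln0 //; lia.
Qed.

(** * Factoring isotone maps into idempotents *)

Lemma isotone_idempotent f :
    isotone f -> decreasing f ->
    (forall y, y \in im f -> f y = Some y) ->
  f = retraction [set x | f x] (im f).
Proof.
move=> /isotoneP isof /decreasingP df fixf; apply/ffunP => x.
case E: (f x) => [y|].
  apply/esym/retractionP; split; first by rewrite inE E.
  - by apply/imP; exists x.
  - exact: df.
  (* An image point [m <= x] satisfies [m = f m <= f x], so [f x] is the greatest image point below
     [x]. *)
  by move=> m /fixf fm mx; apply: isof mx; eassumption.
by rewrite ffunE inE E.
Qed.

(** Image points outside the domain count as moved. The set is empty exactly when [f] is idempotent,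
    and its size is the induction measure of [isotone_gen]. *)
Definition moved f := [set y in im f | f y != Some y].

(* Move the topmost non-fixed image point up to the minimum of its block. *)
Lemma isotone_factor f y0 : isotone f -> decreasing f -> y0 \in moved f ->
  exists g D,
    [/\ isotone g && decreasing g, #|im g| <= #|im f|,
        (D, im f) \in partition_pairs #|im f|,
        f = pcomp g (retraction D (im f)) & #|moved g| < #|moved f|].
Proof.
move=> /isotoneP isof /decreasingP df y0P.
case: (arg_maxnP (P := fun y => y \in moved f) val y0P) => y yP ymax.
have [yim yfix] : y \in im f /\ f y != Some y by move: yP; rewrite inE => /andP.
have [x0 x0y] := imP _ _ yim.
have P0 : (fun x => f x == Some y) x0 by apply/eqP.
case: (arg_minnP (P := fun x => f x == Some y) val P0) => m /eqP my mmin {x0 x0y P0}.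
have fixed z : z \in im f -> y < z -> f z = Some z.
  move=> zim yz; apply/eqP; apply: contraTT yz => zfix.
  by rewrite -leqNgt; apply: ymax; rewrite inE zim.
have ym : y < m.
  rewrite ltn_neqAle (df _ _ my) andbT; apply: contraNneq yfix => eqym.
  by rewrite (val_inj eqym : y = m) my -(val_inj eqym : y = m).
(* No image point lies in the interval from [y] (excluded) to [m]: a fixed [z <= m] would give
   [z = f z <= f m = y]. Hence replacing [y] by [m] keeps the order of the image. *)
have above z : z \in im f -> y < z -> m < z.
  move=> zim yz; rewrite ltnNge; apply/negP => zm.
  by have := isof _ _ _ _ (fixed _ zim yz) my zm; rewrite leqNgt yz.
pose up z := if z == y then m else z.
pose g : ptrans n := [ffun x => omap up (f x)].
have gE x z : g x = Some z -> exists2 z', f x = Some z' & z = up z'.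
  by rewrite ffunE; case: (f x) => //= z' [<-]; exists z'.
have im_f x z : f x = Some z -> z \in im f by move=> fx; apply/imP; exists x.
have le_up z z' : z \in im f -> z' \in im f -> z <= z' -> up z <= up z'.
  move=> zim zim' zz'; rewrite /up.
  case: eqVneq => [zy|zy]; case: eqVneq => [zy'|zy'] //.
  - apply/ltnW/above => //; move: zz'; rewrite zy leq_eqVlt.
    by case/predU1P => // /val_inj eqz; rewrite eqz eqxx in zy'.
  - by apply: leq_trans zz' _; rewrite zy' ltnW.
have imgE : im g = up @: im f.
  apply/setP => z; apply/imP/imsetP => [[x /gE[z' /im_f z'im ->]]|[z' /imP[x fx] ->]].
    by exists z'.
  by exists x; rewrite ffunE fx.
(* The retraction onto [im f] returns [m] to [y], the greatest image point below [m], and fixes all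
   other points of [im g]. *)
exists g, (m |: im f); split.
- apply/andP; split.
    apply/isotoneP => x x' _ _ /gE[z fx ->] /gE[z' fx' ->] xx'.
    by apply: le_up; [apply: im_f fx|apply: im_f fx'|apply: isof xx'; eassumption].
  apply/decreasingP => x _ /gE[z fx ->]; rewrite /up.
  case: eqP => [zy|_]; last exact: df.
  by apply: mmin; rewrite fx zy.
- by rewrite imgE leq_imset_card.
- apply/partition_pairsP; split; rewrite ?subsetU1 // => d.
  by rewrite in_setU1 => /predU1P[->|dim]; [exists y; last exact: ltnW|exists d].
- apply/ffunP => x; rewrite ffunE [g x]ffunE; case fx: (f x) => [z|] //=.
  have zim := im_f _ _ fx; apply/esym/retractionP; rewrite /up.
  case: eqP => [zy|_]; last by split=> //; apply: setU1r.
  rewrite zy; split=> //; first exact: setU11.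
    exact: ltnW.
  move=> z' z'im z'm; rewrite leqNgt; apply/negP => yz'.
  by have := above _ z'im yz'; rewrite ltnNge z'm.
(* The new image point [m] is fixed by [g] because [f m = y], and image points other than [y] that
   [f] fixes stay fixed. *)
have sub : moved g \subset moved f :\ y.
  apply/subsetP => z; rewrite inE => /andP[]; rewrite imgE => /imsetP[z' z'im ->].
  rewrite /up; case: (eqVneq z' y) => zy; first by rewrite ffunE my /= /up !eqxx.
  move=> gz; rewrite in_setD1 zy inE z'im /=; apply: contraNneq gz => fz.
  by rewrite ffunE fz /= /up (negPf zy).
by rewrite (cardsD1 y (moved f)) yP ltnS subset_leq_card.
Qed.

(** * Reflections and the factorization of antitone maps *)

Lemma card_ord_interval (A : {set 'I_n}) l u :
  (forall x, x \in A -> l <= x < u) -> #|A| <= u - l.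
Proof.
move=> H; rewrite cardE -(size_map val) -(size_iota l (u - l)).
apply: uniq_leq_size; first by rewrite map_inj_uniq ?enum_uniq //; apply: val_inj.
by move=> k /mapP[x]; rewrite mem_enum => /H xlu ->; rewrite mem_iota /=; lia.
Qed.

Definition reflection p q : ptrans n :=
  [ffun x : 'I_n => if q <= x < q + p then insub (q + q - x) else None].

Lemma reflectionP p q x y : p <= q.+1 ->
  reflection p q x = Some y <-> q <= x < q + p /\ x + y = q + q.
Proof.
move=> pq; rewrite ffunE; split=> [|[-> xy]].
  case: ifP => // xq; case: insubP => // z _ zE [<-]; rewrite zE; split=> //; lia.
have yE : q + q - x = y by lia.
by rewrite yE valK.
Qed.

Lemma antitone_reflection p q : p <= q.+1 -> antitone (reflection p q).
Proof.
move=> pq; apply/antitoneP => x y x' y' /reflectionP -/(_ pq)[_ ex].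
by case/reflectionP => // _ ey xy; lia.
Qed.

Lemma decreasing_reflection p q : p <= q.+1 -> decreasing (reflection p q).
Proof.
by move=> pq; apply/decreasingP => x x' /reflectionP -/(_ pq)[qx ex]; lia.
Qed.

Lemma leq_card_im_reflection p q : p <= q.+1 -> #|im (reflection p q)| <= p.
Proof.
move=> pq; have -> : p = q.+1 - (q.+1 - p) by lia.
apply: card_ord_interval => y /imP[x].
rewrite (_ : q.+1 - _ = p); last by lia.
by case/reflectionP=> // qx ex; lia.
Qed.

Lemma card_im_reflection p q : p <= q.+1 -> q + p <= n ->
  #|im (reflection p q)| = p.
Proof.
move=> pq qpn; apply/eqP; rewrite eqn_leq leq_card_im_reflection //=.
have lt_n (i : 'I_p) : q - i < n by have := ltn_ord i; lia.
pose h i := Ordinal (lt_n i).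
have h_inj : injective h.
  move=> i j [] hij; apply: val_inj => /=.
  by have := ltn_ord i; have := ltn_ord j; lia.
rewrite -[X in X <= _](card_ord p) -(card_codom h_inj).
apply/subset_leq_card/subsetP => _ /codomP[i ->]; apply/imP.
have lt_n' : q + i < n by have := ltn_ord i; lia.
exists (Ordinal lt_n'); apply/reflectionP => //=.
by have := ltn_ord i; lia.
Qed.

Definition extends f g := [forall x, f x ==> (g x == f x)].

Lemma extendsP f g :
  reflect (forall x y, f x = Some y -> g x = Some y) (extends f g).
Proof.
apply: (iffP forallP) => [H x y fx|H x].
  by have := H x; rewrite fx /= => /eqP.
by apply/implyP; case fx: (f x) => [y|] // _; rewrite (H _ _ fx).
Qed.

(** Since [b] separates the points [a (q + i)], these are distinct. If [a] is isotone, they increase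
    strictly from [a q = q] while staying at most [q + i], so [a] fixes each [q + i] and [b] does
    the reflecting. If [a] is antitone, they decrease strictly from at most [q], so
    [a (q + i) <= q - i], and [b] decreasing gives the reverse inequality. *)
Lemma extends_reflection_pcomp p q a b : p <= q.+1 -> q + p <= n ->
    monotone a -> decreasing a -> decreasing b ->
    extends (reflection p q) (pcomp a b) ->
  extends (reflection p q) a \/ extends (reflection p q) b.
Proof.
move=> pq qpn mono_a /decreasingP da /decreasingP db /extendsP ext.
have ab (x y : 'I_n) : q <= x < q + p -> x + y = q + q ->
    exists2 z, a x = Some z & b z = Some y.
  by move=> qx xy; apply/pcomp_Some/ext/reflectionP.
have pred (x : 'I_n) i : x = q + i.+1 :> nat -> i.+1 < p -> exists x' y' z' : 'I_n,
    [/\ x' = q + i :> nat, x' + y' = q + q, a x' = Some z' & b z' = Some y'].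
  move=> xq ip; have lx : q + i < n by lia.
  have ly : q - i < n by lia.
  case: (ab (Ordinal lx) (Ordinal ly)) => [/=|/=|z' ? ?]; try lia.
  by exists (Ordinal lx), (Ordinal ly), z'; split=> //=; lia.
case/orP: mono_a => [/isotoneP|/antitoneP] mono_a; [right|left].
  have fixa i : i < p -> forall x : 'I_n, x = q + i :> nat -> a x = Some x.
    elim: i => [|i IHi] ip x xq.
      have [||z axz bz] := ab x x; [lia|lia|].
      have := da _ _ axz; have := db _ _ bz => xz zx.
      by rewrite axz; congr Some; apply: val_inj => /=; lia.
    have ly : q - i.+1 < n by lia.
    have [||z axz bz] := ab x (Ordinal ly); [lia|rewrite /=; lia|].
    have [x' [y' [z' [xq' xy' axz' bz']]]] := pred _ _ xq ip.
    have zx' : z' = x' by move: axz'; rewrite IHi //; [case|lia].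
    have xx' : x' <= x by rewrite /=; lia.
    have := mono_a _ _ _ _ axz' axz xx'; have := da _ _ axz => zx zz'.
    have nz : z <> z' :> nat.
      by move/val_inj => eqz; move: bz'; rewrite -eqz bz => -[/(congr1 val)] /=; lia.
    by rewrite axz; congr Some; apply: val_inj => /=; rewrite zx' in zz' nz; lia.
  apply/extendsP => x y /reflectionP -/(_ pq)[qx xy].
  have [z axz bz] := ab _ _ qx xy.
  have xE : x = q + (x - q) :> nat by rewrite /=; lia.
  have ip : x - q < p by lia.
  by move: axz; rewrite (fixa _ ip _ xE) => -[->].
have le_a i : i < p -> forall x z y : 'I_n, x = q + i :> nat -> a x = Some z ->
    b z = Some y -> x + z <= q + q.
  elim: i => [|i IHi] ip x z y xq axz bz.
    by have := da _ _ axz; lia.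
  have ly : q - i.+1 < n by lia.
  have [||z1 axz1 bz1] := ab x (Ordinal ly); [lia|rewrite /=; lia|].
  have [x' [y' [z' [xq' xy' axz' bz']]]] := pred _ _ xq ip.
  have := IHi (ltnW ip) _ _ _ xq' axz' bz'.
  have xx' : x' <= x by rewrite /=; lia.
  have := mono_a _ _ _ _ axz' axz xx'.
  have nz : z <> z' :> nat.
    move/val_inj => eqz; move: bz'; rewrite -eqz.
    by move: axz1; rewrite axz => -[->]; rewrite bz1 => -[/(congr1 val)] /=; lia.
  by move=> *; lia.
apply/extendsP => x y /reflectionP -/(_ pq)[qx xy].
have [z axz bz] := ab _ _ qx xy.
have xE : x = q + (x - q) :> nat by rewrite /=; lia.
have ip : x - q < p by lia.
have := le_a _ ip _ _ _ xE axz bz; have := db _ _ bz => ? ?.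
by rewrite axz; congr Some; apply: val_inj => /=; lia.
Qed.

(* With [rk b] the number of image points above [b], the left factor sends the
   block of [b] to [q + rk b] and the right factor sends [q - rk b] to [b]. *)
Lemma antitone_factor f : antitone f -> decreasing f -> 0 < #|im f| ->
  exists q g h, let p := #|im f| in
    [/\ p <= q.+1 /\ q + p <= n,
        isotone g /\ isotone h, decreasing g /\ decreasing h,
        #|im g| <= p /\ #|im h| <= p &
        f = pcomp (pcomp g (reflection p q)) h].
Proof.
move=> /antitoneP antf /decreasingP df /card_gt0P[y0 y0im].
case: (arg_maxnP (P := fun y => y \in im f) val y0im) => qo qim qmax.
case: (arg_minnP (P := fun y => y \in im f) val y0im) => bo bim bmin.
have im_f x z : f x = Some z -> z \in im f by move=> fx; apply/imP; exists x.
pose q : nat := qo; pose above (b : 'I_n) := [set y in im f | b < y].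
pose rk (b : 'I_n) := #|above b|; pose p := #|im f|.
have rk_lt (b b' : 'I_n) : b' \in im f -> b < b' -> rk b' < rk b.
  move=> b'im bb'; apply/proper_card/properP; split.
    by apply/subsetP => y; rewrite !inE => /andP[-> /(ltn_trans bb')].
  by exists b'; rewrite in_set b'im ?bb' ?ltnn.
have rk_inj (b b' : 'I_n) : b \in im f -> b' \in im f -> rk b = rk b' -> b = b'.
  move=> bim' b'im eqrk; apply: val_inj => /=; case: (ltngtP b b') => // lt_bb'.
    by have := rk_lt _ _ b'im lt_bb'; lia.
  by have := rk_lt _ _ bim' lt_bb'; lia.
have rk_p (b : 'I_n) : b \in im f -> rk b < p.
  move=> bim'; apply/proper_card/properP; split.
    by apply/subsetP => y; rewrite in_set => /andP[].
  by exists b; rewrite // in_set ltnn andbF.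
(* The least image point has all the others above it. Applying [rk_q] and [rk_x] to it yields the
   two bounds on [q]. *)
have rk_bo : p <= (rk bo).+1.
  rewrite -add1n -(cards1 bo) -[X in _ <= X]cardsUI; apply: leq_trans (leq_addr _ _).
  apply/subset_leq_card/subsetP => y yim; rewrite in_setU1 in_set yim /=.
  have [//|yb] := eqVneq y bo.
  by rewrite ltn_neqAle bmin // andbT eq_sym.
have rk_q (b : 'I_n) : b \in im f -> b + rk b <= q.
  move=> bim'; have bq : b <= q by apply: qmax.
  suff : rk b <= q.+1 - b.+1 by lia.
  apply: card_ord_interval => y; rewrite in_set => /andP[yim ->].
  by rewrite ltnS; apply: qmax.
(* This makes [g] decreasing. Preimages of the [rk b] image points above [b] are distinct, lie
   before [x] by antitonicity, and are at least [q]; the default [x] of [pre] is never reached on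
   [above b]. *)
have rk_x (x b : 'I_n) : f x = Some b -> q + rk b <= x.
  move=> fx; pose pre (y : 'I_n) := odflt x [pick x' | f x' == Some y].
  have preP y : y \in above b -> f (pre y) = Some y.
    rewrite in_set /pre => /andP[/imP[x' fx'] _].
    by case: pickP => [x'' /eqP //|/(_ x')]; rewrite fx' eqxx.
  have [x0 fx0] := imP _ _ qim.
  (* A point after [x0] is at least [x0 >= f x0 = q]; a point before [x0] has image at least [q] and
     is not below its image. *)
  have qx x' y : f x' = Some y -> q <= x'.
    move=> fx'; have [x0x'|x'x0] := leqP x0 x'.
      exact: leq_trans (df _ _ fx0) x0x'.
    exact: leq_trans (antf _ _ _ _ fx' fx0 (ltnW x'x0)) (df _ _ fx').
  have -> : rk b = #|pre @: above b|.
    rewrite card_in_imset // => y y' yb y'b eqpre; apply: Some_inj.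
    by rewrite -(preP _ yb) eqpre preP.
  suff : #|pre @: above b| <= x - q by have := qx _ _ fx; lia.
  apply: card_ord_interval => _ /imsetP[y yb ->].
  rewrite (qx _ _ (preP _ yb)) ltnNge; apply/negP => xy.
  have := antf _ _ _ _ fx (preP _ yb) xy.
  by move: yb; rewrite in_set => /andP[_]; rewrite ltnNge => /negP.
have pq : p <= q.+1 by have := rk_q _ bim; lia.
have qpn : q + p <= n.
  have [x fx] := imP _ _ bim.
  by have := rk_x _ _ fx; have := ltn_ord x; lia.
pose g : ptrans n := [ffun x => if f x is Some b then insub (q + rk b) else None].
pose h : ptrans n := [ffun y : 'I_n => [pick b in im f | y + rk b == q]].
have gE (x z : 'I_n) : g x = Some z <-> exists2 b, f x = Some b & z = q + rk b :> nat.
  rewrite ffunE; split=> [|[b -> zE]]; last by rewrite -zE valK.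
  case fx: (f x) => [b|] //; case: insubP => // z' _ z'E [<-].
  by exists b.
have hE (y b : 'I_n) : h y = Some b <-> b \in im f /\ y + rk b = q.
  rewrite ffunE; split=> [|[bim' yb]].
    by case: pickP => // b' /andP[b'im /eqP] yb' [<-].
  case: pickP => [b' /andP[b'im /eqP yb']|/(_ b)/negP[]]; last by rewrite bim' yb /=.
  by congr Some; apply: rk_inj => //; lia.
exists q, g, h; split=> //.
- split; apply/isotoneP.
    move=> x y x' y' /gE[b fx ->] /gE[b' fy ->] xy; rewrite leq_add2l.
    have := antf _ _ _ _ fx fy xy; rewrite leq_eqVlt => /predU1P[/val_inj->//|b'b].
    by apply/ltnW/rk_lt => //; apply: im_f fx.
  move=> x y b b' /hE[bim' xb] /hE[b'im yb'] xy; rewrite leqNgt; apply/negP => b'b.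
  by have := rk_lt _ _ bim' b'b; lia.
- split; apply/decreasingP.
    by move=> x z /gE[b fx ->]; apply: rk_x.
  by move=> y b /hE[bim' yb]; have := rk_q _ bim'; lia.
- split.
    rewrite -/p -[X in _ <= X](addKn q).
    apply: card_ord_interval => z /imP[x /gE[b fx ->]].
    by have := rk_p _ (im_f _ _ fx); lia.
  by apply/subset_leq_card/subsetP => b /imP[y /hE[]].
apply/ffunP => x; case fx: (f x) => [b|]; last by rewrite !ffunE fx.
have bim' := im_f _ _ fx; have rx := rk_x _ _ fx; have rp := rk_p _ bim'.
have lz : q + rk b < n by lia.
have ly : q - rk b < n by lia.
have gx : g x = Some (Ordinal lz) by apply/gE; exists b.
have rz : reflection p q (Ordinal lz) = Some (Ordinal ly).
  by apply/reflectionP => //=; lia.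
have hy : h (Ordinal ly) = Some b by apply/hE; split=> //=; lia.
by rewrite ffunE [pcomp g _ x]ffunE gx /= -/p rz /= hy.
Qed.

End PartialMaps.

(** * Passage between partial maps and the Rees quotient *)

Definition layer n p (f : ptrans n) := [&& monotone f, decreasing f & #|im f| == p].

(** Made total by sending maps outside the monoid or of height other than [p] to zero, so that
    arguments can be carried out on bare partial maps. *)
Definition of_ptrans p n (f : ptrans n) : RQ p n := obind (@rees_proj p n) (insub f).

Section Layer.

Variables p n : nat.
Hypothesis p_gt0 : 0 < p.
Implicit Types (f g h : ptrans n) (u : RQ p n).

(** Composition cannot raise the height, so factors of height at most [p] of a map of height [p]
    have height exactly [p]. *)
Lemma layer_pcomp_le f g h :
    monotone g && decreasing g -> monotone h && decreasing h ->
    #|im g| <= p -> #|im h| <= p -> layer p f -> f = pcomp g h ->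
  layer p g /\ layer p h.
Proof.
move=> /andP[mg dg] /andP[mh dh] gp hp /and3P[_ _ /eqP cf] fE.
split; apply/and3P; split=> //; rewrite eqn_leq ?gp ?hp -[X in X <= _]cf fE.
  exact: card_im_pcompl.
exact: card_im_pcompr.
Qed.

Lemma of_ptransK f : layer p f ->
  exists2 s, of_ptrans p f = Some s & val (val s) = f.
Proof.
case/and3P=> mf df /eqP cf; have mdf : monotone f && decreasing f by rewrite mf.
have fL : MkDORP mdf \in I_ n p :\: I_ n p.-1 by rewrite in_layer // /height cf.
exists (Sub (MkDORP mdf) fL) => //; rewrite /of_ptrans.
by rewrite (insubT (fun f => monotone f && decreasing f) mdf) /= /rees_proj insubT.
Qed.

Lemma layer_val (s : {rho : DORP n | rho \in I_ n p :\: I_ n p.-1}) :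
  layer p (val (val s)).
Proof.
have := valP s; rewrite in_layer // => /eqP hs.
by have /andP[ms ds] := dorp_prop (val s); apply/and3P; split=> //; apply/eqP.
Qed.

Lemma of_ptrans_val (s : {rho : DORP n | rho \in I_ n p :\: I_ n p.-1}) :
  of_ptrans p (val (val s)) = Some s.
Proof.
have [s' -> vs] := of_ptransK (layer_val s).
by congr Some; do 2!apply: val_inj.
Qed.

Lemma RQ_cases u : u = None \/ exists2 f, layer p f & u = of_ptrans p f.
Proof.
case: u => [s|]; last by left.
by right; exists (val (val s)); [apply: layer_val|rewrite of_ptrans_val].
Qed.

Lemma of_ptrans_neq0 f : layer p f -> of_ptrans p f <> None.
Proof. by case/of_ptransK => s ->. Qed.

Lemma of_ptrans_inj : {in layer p &, injective (@of_ptrans p n)}.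
Proof.
move=> f g /of_ptransK[s -> <-] /of_ptransK[t -> <-] [->] //.
Qed.

Lemma of_ptransM f g : layer p f -> layer p g ->
  (of_ptrans p f * of_ptrans p g)%g =
    if layer p (pcomp f g) then of_ptrans p (pcomp f g) else None.
Proof.
case/of_ptransK=> s -> vs /of_ptransK[t -> vt].
have -> : pcomp f g = val (val s * val t)%g by rewrite -vs -vt.
change (rees_proj p (val s * val t)%g = if layer p (val (val s * val t)%g)
   then of_ptrans p (val (val s * val t)%g) else None).
have stI : (val s * val t)%g \in I_ n p by apply: I_mulr; case/setDP: (valP s).
case: (rees_projP stI) => [w vw|]; first by rewrite -vw layer_val of_ptrans_val.
rewrite inE => hst; case: ifP => // /and3P[_ _ /eqP cst].
by move: hst; rewrite /height cst => ?; lia.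
Qed.

(** A nonzero product comes from a genuine composition in the layer; this reduces primality in the
    quotient to factorizations of maps. *)
Lemma of_ptransM_eq u v f : layer p f -> (u * v)%g = of_ptrans p f ->
  exists g h, [/\ layer p g, layer p h, u = of_ptrans p g, v = of_ptrans p h
                 & pcomp g h = f].
Proof.
move=> Lf; case: (RQ_cases u) => [->|[g Lg ->]].
  by move/esym/(of_ptrans_neq0 Lf).
case: (RQ_cases v) => [->|[h Lh ->]].
  case/of_ptransK: (Lg) => s -> _ /esym/(of_ptrans_neq0 Lf) //.
rewrite of_ptransM //; case: ifP => [Lgh eqf|_ /esym/(of_ptrans_neq0 Lf) //].
by exists g, h; split=> //; apply: of_ptrans_inj eqf.
Qed.

Lemma layer_retraction (D M : {set 'I_n}) :
  (D, M) \in partition_pairs n p -> layer p (retraction D M).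
Proof.
move=> DM; apply/and3P; split.
- by rewrite /monotone isotone_retraction.
- exact: decreasing_retraction.
by rewrite (im_retraction DM); case/partition_pairsP: DM => _ /eqP.
Qed.

Lemma layer_reflection q : p <= q.+1 -> q + p <= n -> layer p (reflection n p q).
Proof.
move=> pq qpn; apply/and3P; split.
- by rewrite /monotone antitone_reflection ?orbT.
- exact: decreasing_reflection.
by rewrite card_im_reflection.
Qed.

(** * The lower bound on the rank *)

Lemma prime_set_retraction (D M : {set 'I_n}) :
  (D, M) \in partition_pairs n p -> prime_set [set of_ptrans p (retraction D M)].
Proof.
move=> DM u v; rewrite !in_set1 => /eqP /(of_ptransM_eq (layer_retraction DM)).
(* It is always the left factor that equals the idempotent. *)
move=> [g [h [/and3P[_ dg /eqP cg] /and3P[_ dh _] -> _ ghE]]]; left.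
apply/eqP; congr of_ptrans; apply: idempotent_left_factor dg dh _ ghE _.
  by case/and3P: (layer_retraction DM) => _ _ /eqP->.
exact: retraction_idem DM.
Qed.

Definition extensions q : {set RQ p n} :=
  [set of_ptrans p f | f in
     [pred f : ptrans n | layer p f & extends (reflection n p q) f]].

Lemma prime_set_extensions q : p <= q.+1 -> q + p <= n -> prime_set (extensions q).
Proof.
move=> pq qpn u v /imsetP[f /andP[Lf ext]] /(of_ptransM_eq Lf).
move=> [g [h [Lg Lh -> -> ghE]]]; rewrite -ghE in ext.
have [/and3P[mg dg _] /and3P[_ dh _]] := (Lg, Lh).
case: (extends_reflection_pcomp pq qpn mg dg dh ext) => ?; [left|right].
  by apply/imsetP; exists g => //; apply/andP.
by apply/imsetP; exists h => //; apply/andP.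
Qed.

Lemma extends_reflection_not_isotone q f : 1 < p -> p <= q.+1 -> q + p <= n ->
  extends (reflection n p q) f -> ~~ isotone f.
Proof.
move=> p_gt1 pq qpn /extendsP ext; apply/isotoneP => isof.
have [lq lq1 lq2] : [/\ q < n, q.+1 < n & q.-1 < n] by split; lia.
have fq : f (Ordinal lq) = Some (Ordinal lq) by apply/ext/reflectionP => //=; lia.
have fq1 : f (Ordinal lq1) = Some (Ordinal lq2) by apply/ext/reflectionP => //=; lia.
by have := isof _ _ _ _ fq fq1; rewrite /=; lia.
Qed.

(** The map cannot be isotone, and an antitone map has at most one fixed point, while both [q] and
    [q'] are fixed. *)
Lemma extends_reflection_inj q q' f : 1 < p ->
    p <= q.+1 -> q + p <= n -> p <= q'.+1 -> q' + p <= n -> monotone f ->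
    extends (reflection n p q) f -> extends (reflection n p q') f ->
  q = q'.
Proof.
move=> p_gt1 pq qpn pq' qpn' mf ext ext'.
case/orP: mf => [|/antitoneP antf].
  by move=> isof; have := extends_reflection_not_isotone p_gt1 pq qpn ext; rewrite isof.
have [lq lq'] : q < n /\ q' < n by split; lia.
move/extendsP: ext => ext; move/extendsP: ext' => ext'.
have fq : f (Ordinal lq) = Some (Ordinal lq) by apply/ext/reflectionP => //=; lia.
have fq' : f (Ordinal lq') = Some (Ordinal lq') by apply/ext'/reflectionP => //=; lia.
have := antf _ _ _ _ fq fq'; have := antf _ _ _ _ fq' fq.
by rewrite /=; lia.
Qed.

(* For [p = 1] antitone maps are isotone; for [n + 2 <= 2 * p] the truncated
   subtraction gives [0], and the layer has no antitone maps at all. *)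
Definition nb_reflections := if p == 1 then 0 else n + 2 - 2 * p.

(** The centres are indexed as [q = p - 1 + j], which runs from [p - 1] to [n - p]. *)
Lemma nb_reflections_bound j : j < nb_reflections ->
  [/\ 1 < p, p <= (p - 1 + j).+1 & p - 1 + j + p <= n].
Proof. by rewrite /nb_reflections; case: eqP => // ? ?; split; lia. Qed.

Lemma leq_rank : #|partition_pairs n p| + nb_reflections <= rank (RQ p n).
Proof.
have [[T genT <-] _] := rankP (RQ p n).
pose I := ({z | z \in partition_pairs n p} + 'I_nb_reflections)%type.
pose A (i : I) : {set RQ p n} := match i with
  | inl z => [set of_ptrans p (retraction (val z).1 (val z).2)]
  | inr j => extensions (p - 1 + j)
  end.
have -> : #|partition_pairs n p| + nb_reflections = #|{: I}|.
  by rewrite card_sum card_sig card_ord.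
apply: (leq_card_generates (A := A) genT).
- case=> [[[D M] DM]|j] /=; first exact: prime_set_retraction.
  by have [_ ? ?] := nb_reflections_bound (ltn_ord j); apply: prime_set_extensions.
- case=> [z|j] /=; apply/set0Pn.
    by exists (of_ptrans p (retraction (val z).1 (val z).2)); rewrite set11.
  have [_ pq qpn] := nb_reflections_bound (ltn_ord j).
  exists (of_ptrans p (reflection n p (p - 1 + j))); apply/imsetP.
  exists (reflection n p (p - 1 + j)) => //; apply/andP; split.
    exact: layer_reflection.
  exact/extendsP.
have disj (D M : {set 'I_n}) (j : 'I_nb_reflections) : (D, M) \in partition_pairs n p ->
    of_ptrans p (retraction D M) \notin extensions (p - 1 + j).
  move=> DM; have [p1 pq qpn] := nb_reflections_bound (ltn_ord j).
  apply/negP => /imsetP[f /andP[Lf ext]] /of_ptrans_inj eqf.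
  have /negP[] := extends_reflection_not_isotone p1 pq qpn ext.
  by rewrite -eqf ?isotone_retraction //; apply: layer_retraction.
case=> [[[D M] DM]|j] [[[D' M'] DM']|j'] x /=.
- move=> /set1P-> /set1P /of_ptrans_inj eqR; congr inl; apply: val_inj.
  apply: (retraction_inj DM DM'); apply: eqR; exact: layer_retraction.
- by move=> /set1P-> ; move/negP: (disj _ _ j' DM).
- by move=> xj /set1P xE; move: xj; rewrite xE; move/negP: (disj _ _ j DM').
move=> /imsetP[f /andP[Lf ext] ->] /imsetP[f' /andP[Lf' ext']].
move/(of_ptrans_inj Lf Lf') => eqf; rewrite -eqf in ext'.
have [p1 pq qpn] := nb_reflections_bound (ltn_ord j).
have [_ pq' qpn'] := nb_reflections_bound (ltn_ord j').
have /and3P[mf _ _] := Lf.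
have := extends_reflection_inj p1 pq qpn pq' qpn' mf ext ext'.
by move/addnI => eqj; congr inr; apply: val_inj.
Qed.

(** * The upper bound: retractions and reflections generate *)

Definition generators : {set RQ p n} :=
  [set of_ptrans p (retraction z.1 z.2) | z in partition_pairs n p] :|:
  [set of_ptrans p (reflection n p (p - 1 + j)) | j : 'I_nb_reflections].

Section Generation.

Variable A : {set RQ p n}.
Hypotheses (subA : generators \subset A) (closedA : mul_closed A).

Lemma retraction_gen (D M : {set 'I_n}) :
  (D, M) \in partition_pairs n p -> of_ptrans p (retraction D M) \in A.
Proof.
move=> DM; apply/(subsetP subA)/setUP; left.
by apply/imsetP; exists (D, M).
Qed.

Lemma pcomp_gen f g : layer p f -> layer p g -> layer p (pcomp f g) ->
  of_ptrans p f \in A -> of_ptrans p g \in A -> of_ptrans p (pcomp f g) \in A.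
Proof.
move=> Lf Lg Lfg fA gA.
have := mul_closedP _ closedA _ _ fA gA.
by rewrite of_ptransM // Lfg.
Qed.

(** Induction on the number of moved points: [isotone_factor] splits off a retraction and lowers it,
    and a map without moved points is itself a retraction. *)
Lemma isotone_gen f : layer p f -> isotone f -> of_ptrans p f \in A.
Proof.
elim: {f}_.+1 {-2}f (ltnSn #|moved f|) => // k IHk f lt_k Lf isof.
have /and3P[mf df /eqP cf] := Lf.
have [mv0|[y yf]] := set_0Vmem (moved f).
  have fixf y : y \in im f -> f y = Some y.
    move=> yim; apply/eqP; apply: contraFT (in_set0 y) => fy.
    by rewrite -mv0 in_set yim.
  rewrite (isotone_idempotent isof df fixf); apply: retraction_gen.
  apply/partition_pairsP; split=> // [|d].
    by apply/subsetP => y yim; rewrite inE fixf.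
  rewrite inE; case fd: (f d) => [y|] // _; exists y; first by apply/imP; exists d.
  exact: (decreasingP _ df).
have [g [D [/andP[isog dg] gp DM fE lt_g]]] := isotone_factor isof df yf.
rewrite cf in gp DM.
have [|||Lg Lr] := layer_pcomp_le _ _ gp _ Lf fE.
- by rewrite /monotone isog.
- by rewrite /monotone isotone_retraction decreasing_retraction.
- by rewrite (im_retraction DM) cf.
rewrite fE; apply: pcomp_gen; rewrite -?fE //; last exact: retraction_gen.
by apply: IHk => //; apply: leq_trans lt_g _.
Qed.

Lemma antitone_gen f : layer p f -> antitone f -> of_ptrans p f \in A.
Proof.
move=> Lf antf; have /and3P[mf df /eqP cf] := Lf.
(* A map of height 1 is constant on its domain, hence also isotone; there are no reflections among
   the generators in this case. *)
have [p1|p1] := eqVneq p 1.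
  apply: isotone_gen => //; apply/isotoneP => x y x' y' fx fy _.
  have /card_le1_eqP im1 : #|im f| <= 1 by rewrite cf p1.
  by rewrite (im1 x' y') //; apply/imP; [exists x|exists y].
have [|q [g [h []]]] := antitone_factor antf df; first by rewrite cf.
rewrite cf => -[pq qpn] [isog isoh] [dg dh] [gp hp] fE.
have Lr := layer_reflection pq qpn; have /and3P[mr dr cr] := Lr.
have mg : monotone g by rewrite /monotone isog.
have mh : monotone h by rewrite /monotone isoh.
have [|||Lgr Lh] := layer_pcomp_le _ _ _ hp Lf fE.
- by rewrite monotone_pcomp // decreasing_pcomp.
- by rewrite mh.
- exact: leq_trans (card_im_pcompl _ _) gp.
have [|||Lg _] := layer_pcomp_le _ _ gp _ Lgr erefl.
- by rewrite mg.
- by rewrite mr.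
- by rewrite (eqP cr).
rewrite fE; apply: pcomp_gen; rewrite -?fE //; last exact: isotone_gen.
apply: pcomp_gen => //; first exact: isotone_gen.
apply/(subsetP subA)/setUP; right; apply/imsetP.
have lt_j : q + 1 - p < nb_reflections.
  by rewrite /nb_reflections (negPf p1); clear -pq qpn; lia.
exists (Ordinal lt_j) => //=; congr (of_ptrans _ (reflection _ _ _)).
by clear -p_gt0 pq; lia.
Qed.

(** For two distinct sets [D] and [D'] of size [p], the partial identities on them compose to a map
    with image inside [D :&: D'], which has fewer than [p] points. *)
Lemma zero_gen : p < n -> None \in A.
Proof.
move=> pn; have : 1 < #|[set D : {set 'I_n} | #|D| == p]|.
  (* Two such sets exist because Pascal's rule writes the binomial coefficient as a sum of two
     positive terms when [p < n]. *)
  rewrite card_draws card_ord; case: n pn => // m; case: (p) p_gt0 => // r _ rm.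
  by rewrite binS -addn1 leq_add // bin_gt0 //; lia.
move=> /card_gt1P[D [D' []]]; rewrite !inE => /eqP cD /eqP cD' neqD.
have DD (E : {set 'I_n}) : #|E| = p -> (E, E) \in partition_pairs n p.
  by move=> cE; apply/partition_pairsP; split=> // d dE; exists d.
have := mul_closedP _ closedA _ _ (retraction_gen (DD _ cD)) (retraction_gen (DD _ cD')).
rewrite of_ptransM; try exact/layer_retraction/DD.
case: ifP => // /and3P[_ _ /eqP cDD'] _.
have sub : im (pcomp (retraction D D) (retraction D' D')) \subset D :&: D'.
  apply/subsetP => z /imP[x /pcomp_Some[y /retractionP[_ yD _ _]]].
  case/retractionP => yD' zD' zy maxz; rewrite inE zD' andbT.
  suff -> : z = y by [].
  by apply/val_inj/eqP; rewrite eqn_leq zy maxz.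
have leI : p <= #|D :&: D'| by rewrite -cDD' subset_leq_card.
case/negP: neqD; apply/eqP/eqP.
have -> : D = D :&: D' by apply/esym/eqP; rewrite eqEcard subsetIl cD.
by rewrite eqEcard subsetIr cD' .
Qed.

End Generation.

Lemma generates_generators : p < n -> generates generators.
Proof.
move=> pn; apply/generatesP => A subA closedA; apply/setP => u; rewrite inE.
case: (RQ_cases u) => [->|[f Lf ->]]; first exact: zero_gen.
have /and3P[/orP[isof|antf] _ _] := Lf; first exact: isotone_gen.
exact: antitone_gen.
Qed.

(** The generators are indexed by the same families as the prime sets of [leq_rank], so the two
    bounds meet. *)
Lemma rank_RQ : p < n -> rank (RQ p n) =
  nb_reflections + \sum_(p <= r < n.+1) 'C(n, r) * 'C(r - 1, p - 1).
Proof.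
move=> pn; rewrite -card_partition_pairs // addnC.
apply/eqP; rewrite eqn_leq leq_rank andbT.
have [_ /(_ _ (generates_generators pn)) le_rank] := rankP (RQ p n).
apply: leq_trans le_rank _; apply: leq_trans (leq_card_setU _ _) _.
apply: leq_add; first exact: leq_imset_card.
by apply: leq_trans (leq_imset_card _ _) _; rewrite card_ord.
Qed.

End Layer.

Theorem theorem3p11 (n p : nat) (hp : 1 <= p <= n - 1) :
  (p = 1 \/ uphalf n + 1 <= p <= n - 1 ->
     rank (RQ p n) = \sum_(p <= r < n.+1) 'C(n, r) * 'C(r - 1, p - 1)) /\
  (2 <= p <= uphalf n ->
     rank (RQ p n) =
       (n + 2 - 2 * p) + \sum_(p <= r < n.+1) 'C(n, r) * 'C(r - 1, p - 1)).
Proof.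
have [p_gt0 pn] : 0 < p /\ p < n by split; lia.
rewrite (rank_RQ p_gt0 pn) /nb_reflections; split=> [hp'|hp'].
  (* Here [p] is at least [uphalf n + 1], so [2 * p >= n + 2] and the subtraction truncates to
     zero. *)
  case: eqP => // p1; have -> : n + 2 - 2 * p = 0 by lia.
  by rewrite add0n.
by case: eqP => // p1; lia.
Qed.
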